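(* For every prime $m \geq 3$, the join graph $\Gamma(\mathbb{Z}_{2m}) + \Gamma(\mathbb{Z}_4)$ does not admit a distance antimagic labeling.
   Context: For an integer $n \geq 2$, the zero-divisor graph $\Gamma(\mathbb{Z}_n)$ is the simple graph whose vertex set is the set of nonzero zero-divisors of the ring $\mathbb{Z}_n$, two distinct vertices $u,v$ being adjacent iff $uv \equiv 0 \pmod n$. For graphs $G,H$, the join $G+H$ is the graph obtained from the disjoint union of $G$ and $H$ by adding every edge between a vertex of $G$ and a vertex of $H$. A distance antimagic labeling (DAML) of a graph $G$ with $N$ vertices is a bijection $f:V(G)\to\{1,\dots,N\}$ such that the weights $w(v)=\sum_{u\in N(v)} f(u)$, where $N(v)$ is the open neighbourhood of $v$, are pairwise distinct over all vertices $v$. A graph admits DAML if such a labeling exists. *)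

(* Defs.v *)
From HB Require Import structures.
From mathcomp Require Import all_boot all_order all_algebra.

Set Implicit Arguments.
Unset Strict Implicit.
Unset Printing Implicit Defensive.

Import GRing.Theory.
Local Open Scope ring_scope.

Record sgraph := SGraph {
  vertex :> finType;
  adj : rel vertex;
  adj_sym : symmetric adj;
  adj_irr : irreflexive adj
}.

Section ZeroDivisorGraph.
Variable R : finComNzRingType.

Definition zero_divisor (x : R) : bool := [exists y : R, (y != 0) && (x * y == 0)].

Definition zd_vertex : finType := {x : R | (x != 0) && zero_divisor x}.

Definition zd_adj : rel zd_vertex :=
  fun u v => (u != v) && (val u * val v == 0).

Lemma zd_adj_sym : symmetric zd_adj.
Proof. by move=> u v; rewrite /zd_adj eq_sym mulrC. Qed.

Lemma zd_adj_irr : irreflexive zd_adj.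
Proof. by move=> u; rewrite /zd_adj eqxx. Qed.

Definition zd_graph : sgraph := SGraph zd_adj_sym zd_adj_irr.

End ZeroDivisorGraph.

(* 'Z_n is the ring of integers modulo n only for 1 < n. *)
Definition Gamma (n : nat) : sgraph := zd_graph 'Z_n.

Section Join.
Variables G H : sgraph.

Definition join_adj : rel (G + H)%type := fun x y =>
  match x, y with
  | inl u, inl v => adj u v
  | inr u, inr v => adj u v
  | _, _ => true
  end.

Lemma join_adj_sym : symmetric join_adj.
Proof. by move=> [u|u] [v|v] //=; rewrite adj_sym. Qed.

Lemma join_adj_irr : irreflexive join_adj.
Proof. by move=> [u|u] /=; rewrite adj_irr. Qed.

Definition join : sgraph := SGraph join_adj_sym join_adj_irr.

End Join.

Section DistanceAntimagic.
Variable G : sgraph.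

Definition weight (f : G -> nat) (v : G) : nat := (\sum_(u : G | adj v u) f u)%N.

Definition is_DAML (f : G -> nat) : Prop :=
  [/\ injective f,
      forall k : nat, (k \in codom f) = (1 <= k <= #|G|)%N
    & injective (weight f)].

Definition admits_DAML : Prop := exists f : G -> nat, is_DAML f.

End DistanceAntimagic.

(* Main.v *)
(* The graph [Gamma (2 * m)] is a star whose leaves are the nonzero even
   residues.  For [m >= 3] it has the two leaves 2 and 4, which have the same
   neighbourhood in the join, hence the same weight under every labeling. *)

Require Import Defs.
From mathcomp Require Import all_boot all_order all_algebra.

Import GRing.Theory.
Local Open Scope ring_scope.

Lemma Zp_natr_eq0 (p k : nat) : (1 < p)%N -> (k%:R == 0 :> 'Z_p) = (p %| k)%N.
Proof. by move=> p_gt1; rewrite -val_eqE /= val_Zp_nat. Qed.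

Lemma weight_eq_adj (G : sgraph) (f : G -> nat) (u v : G) :
  @adj G u =1 @adj G v -> weight f u = weight f v.
Proof. by move=> eq_uv; apply: eq_bigl. Qed.

Lemma join_adj_inl_eq (G H : sgraph) (u v : G) :
  @adj G u =1 @adj G v ->
  @adj (join G H) (inl u) =1 @adj (join G H) (inl v).
Proof. by move=> eq_uv [w|w] //=; apply: eq_uv. Qed.

Section TwinLeaves.
Variables (m : nat) (m_prime : prime m) (m_ge3 : (3 <= m)%N).

Let n_gt1 : (1 < 2 * m)%N.
Proof. by rewrite mul2n -addnn ltn_addr // ltnW. Qed.

Let m_odd : odd m.
Proof. by case: (even_prime m_prime) m_ge3 => [-> |]. Qed.

(** Otherwise the prime [m] divides [2 ^ k], hence 2, against [m >= 3]. *)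
Let not_dvd_pow2 k : ~~ (2 * m %| 2 ^ k)%N.
Proof.
apply/negP => /(dvdn_trans (dvdn_mull 2 (dvdnn m))).
by rewrite Euclid_dvdX // => /andP[/(@dvdn_leq _ 2 isT)]; rewrite leqNgt m_ge3.
Qed.

Let pow2_neq0 k : (2 ^ k)%:R != 0 :> 'Z_(2 * m).
Proof. by rewrite Zp_natr_eq0. Qed.

Let m_neq0 : m%:R != 0 :> 'Z_(2 * m).
Proof.
rewrite Zp_natr_eq0 //; apply: contraL m_odd => /(dvdn_trans (dvdn_mulr m (dvdnn 2))).
by rewrite dvdn2.
Qed.

Lemma zd_vertex_pow2 k : (0 < k)%N ->
  ((2 ^ k)%:R != 0 :> 'Z_(2 * m)) && zero_divisor ((2 ^ k)%:R : 'Z_(2 * m)).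
Proof.
(* The witness [m] annihilates positive powers of 2: [2 ^ k.+1 * m = 2 ^ k * (2 * m)]. *)
case: k => // k _; rewrite pow2_neq0 /=; apply/existsP; exists m%:R.
by rewrite m_neq0 -natrM Zp_natr_eq0 // expnSr -mulnA dvdn_mull.
Qed.

(* As [m] is odd, [(m.+1)./2] is an integer, and [(m.+1)./2 * 4 = 2 * m + 2 = 2]
   modulo [2 * m]. *)
Lemma mul4_eq0 (v : 'Z_(2 * m)) : (4%:R * v == 0) = (2%:R * v == 0).
Proof.
apply/eqP/eqP => [v4_0 | v2_0]; last by rewrite (natrM _ 2 2) -mulrA v2_0 mulr0.
have -> : 2%:R = (m.+1)./2%:R * 4%:R :> 'Z_(2 * m).
  have -> : (m.+1)./2%:R * 4%:R = (2 * m + 2)%:R :> 'Z_(2 * m).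
    rewrite -natrM; congr _%:R; rewrite -[4%N]/(2 * 2)%N mulnA !muln2.
    by rewrite (@even_halfK m.+1) /= ?m_odd // mul2n addn2.
  by rewrite natrD pchar_Zp // add0r.
by rewrite -mulrA v4_0 mulr0.
Qed.

(** The membership proofs for [2 ^ 1] and [2 ^ 2] fit here because these powers compute to 2 and
    4. *)
Definition leaf2 : Gamma (2 * m) := Sub 2%:R (zd_vertex_pow2 1 isT).
Definition leaf4 : Gamma (2 * m) := Sub 4%:R (zd_vertex_pow2 2 isT).

Lemma leaf2_neq_leaf4 : leaf2 <> leaf4.
Proof.
move=> /(congr1 val)/= /eqP; rewrite eq_sym -subr_eq0 -natrB //.
(* The difference [4 - 2] is [2 ^ 1]. *)
exact/negP/(pow2_neq0 1).
Qed.

(** When [u * u] is nonzero, [u * v = 0] already forces [v] to differ from [u]. Neighbourhoods can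
    then be compared through annihilators. *)
Lemma zd_adj_sqr_neq0 (R : finComNzRingType) (u v : zd_graph R) :
  val u * val u != 0 -> adj u v = (val u * val v == 0).
Proof.
by move=> u2_neq0; rewrite /= /zd_adj; case: eqP => //= <-; apply/esym/negbTE.
Qed.

Lemma adj_leaf2_leaf4 : @adj (Gamma (2 * m)) leaf2 =1 @adj (Gamma (2 * m)) leaf4.
Proof.
move=> v; rewrite !zd_adj_sqr_neq0 /= -?natrM.
- by rewrite mul4_eq0.
(* The squares of 4 and 2 are [2 ^ 4] and [2 ^ 2], both nonzero modulo [2 * m]. *)
- exact: (pow2_neq0 4).
- exact: (pow2_neq0 2).
Qed.

End TwinLeaves.

Local Close Scope ring_scope.

Theorem theorem2p1 (m : nat) (hm : prime m) (hm3 : 3 <= m) :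
  ~ admits_DAML (join (Gamma (2 * m)) (Gamma 4)).
Proof.
case=> f [_ _ weight_inj]; apply: (leaf2_neq_leaf4 m hm hm3).
have eq_adj := join_adj_inl_eq _ (Gamma 4) _ _ (adj_leaf2_leaf4 m hm hm3).
exact: inl_inj (weight_inj _ _ (weight_eq_adj _ f _ _ eq_adj)).
Qed.
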